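(* Let $A=\{(x,y): x,y\in\mathbb{Z}_{\geq 0}^2,\ \det(x\ y)=1\}$ be the set of ordered pairs of lattice vectors in the closed first quadrant spanning a parallelogram of oriented area one. Then $$\sum_{(x,y)\in A}\frac{|x|+|y|-|x+y|}{|x|\,|y|\,|x+y|}=\frac{\pi}{2}-1.$$
   Context: For $x,y\in\mathbb{R}^2$, $(x\ y)$ denotes the $2\times 2$ matrix with columns $x$ and $y$, and $|\cdot|$ is the Euclidean norm on $\mathbb{R}^2$. *)

(* Defs.v *)
From HB Require Import structures.
From mathcomp Require Import all_boot all_order all_algebra.
From mathcomp Require Import all_classical all_reals all_analysis.

Set Implicit Arguments.
Unset Strict Implicit.
Unset Printing Implicit Defensive.

Import Order.TTheory GRing.Theory Num.Theory.
Local Open Scope classical_set_scope.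
Local Open Scope ring_scope.

(* MathComp-Analysis' `|v| on matrices is the sup norm, hence this definition. *)
Definition enorm (R : realType) (v : 'cV[R]_2) : R :=
  Num.sqrt (\sum_(i < 2) v i ord0 ^+ 2).

Definition real_vec (R : realType) (x : 'cV[int]_2) : 'cV[R]_2 :=
  map_mx intr x.

Definition nonneg_vec (x : 'cV[int]_2) : Prop := forall i, 0 <= x i ord0.

Definition unimodular_pairs : set ('cV[int]_2 * 'cV[int]_2) :=
  [set p | nonneg_vec p.1 /\ nonneg_vec p.2 /\
           \det (row_mx p.1 p.2 : 'M[int]_2) = 1].

Definition summand (R : realType) (x y : 'cV[R]_2) : R :=
  (enorm x + enorm y - enorm (x + y)) / (enorm x * enorm y * enorm (x + y)).

(* Main.v *)
Require Import Defs.
From HB Require Import structures.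
From mathcomp Require Import all_boot all_order all_algebra.
From mathcomp Require Import all_classical all_reals all_analysis.
From mathcomp Require Import zify ring lra.

(** Replacing (x, y) by (x, x + y) or (x + y, y) arranges the unimodular pairs
    of the first quadrant into a binary tree rooted at the standard basis.
    Since det (x y) = 1, the angle between x and y has sine 1 / (|x| |y|), and
    the summand at (x, y) is the sum of the sines at the two children minus the
    sine at (x, y).  Hence the sum over the first n levels telescopes to the sum
    of the sines at level n, minus 1.  The angles at level n add up to pi / 2
    and tend uniformly to 0, so the sines at level n add up to a quantity
    tending to pi / 2. *)

Set Implicit Arguments.
Unset Strict Implicit.
Unset Printing Implicit Defensive.

Import Order.TTheory GRing.Theory Num.Theory.
Import numFieldTopology.Exports.
Local Open Scope classical_set_scope.
Local Open Scope ring_scope.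

Local Notation ivec := 'cV[int]_2.

(** * Two-dimensional vectors and determinants *)

Lemma ord2P (i : 'I_2) : i = 0 \/ i = 1.
Proof. by case: i => [[|[|//]] i2]; [left|right]; apply: val_inj. Qed.

Lemma cV2P (T : Type) (x y : 'cV[T]_2) :
  x 0 0 = y 0 0 -> x 1 0 = y 1 0 -> x = y.
Proof.
by move=> xy0 xy1; apply/colP => i; have [->|->] := ord2P i.
Qed.

Lemma det_mx2 (T : comNzRingType) (M : 'M[T]_2) :
  \det M = M 0 0 * M 1 1 - M 0 1 * M 1 0.
Proof.
rewrite (expand_det_row _ 0) big_ord_recl big_ord1 /cofactor !det_mx11 !mxE.
have -> : lift 0 0 = 1 :> 'I_2 by apply: val_inj.
have -> : lift 1 0 = 0 :> 'I_2 by apply: val_inj.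
by rewrite /= expr0 expr1 mul1r mulN1r mulrN.
Qed.

Lemma unimodular_pairsE (p : ivec * ivec) :
  unimodular_pairs p <->
  [/\ 0 <= p.1 0 0, 0 <= p.1 1 0, 0 <= p.2 0 0, 0 <= p.2 1 0
    & p.1 0 0 * p.2 1 0 - p.2 0 0 * p.1 1 0 = 1].
Proof.
have detE : \det (row_mx p.1 p.2 : 'M[int]_2) =
    p.1 0 0 * p.2 1 0 - p.2 0 0 * p.1 1 0.
  pose M : 'M[int]_2 := row_mx p.1 p.2; rewrite -[row_mx _ _]/M.
  have M0 i : M i 0 = p.1 i 0.
    by rewrite -(row_mxEl p.1 p.2 i 0) /M; congr (row_mx _ _ _ _); apply: val_inj.
  have M1 i : M i 1 = p.2 i 0.
    by rewrite -(row_mxEr p.1 p.2 i 0) /M; congr (row_mx _ _ _ _); apply: val_inj.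
  by rewrite det_mx2 !M0 !M1.
have nonnegE (v : ivec) : nonneg_vec v <-> 0 <= v 0 0 /\ 0 <= v 1 0.
  split=> [v0|[v0 v1] i]; first by split; apply: v0.
  by have [->|->] := ord2P i.
rewrite /unimodular_pairs /= detE !nonnegE.
by split=> [[[? ?] [[? ?] ?]]|[? ? ? ? ?]]; do ?split.
Qed.

Lemma enormE (R : realType) (v : 'cV[R]_2) :
  enorm v = Num.sqrt (v 0 0 ^+ 2 + v 1 0 ^+ 2).
Proof.
rewrite /enorm big_ord_recl big_ord1.
by have -> : lift ord0 ord0 = 1 :> 'I_2 by apply: val_inj.
Qed.

(* [mxE] leaves entries typed in the additive structure of [int], which [lia]
   does not identify with plain entries. *)
Lemma ivecDE (x y : ivec) i : (x + y) i 0 = x i 0 + y i 0.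
Proof. by rewrite mxE. Qed.

Lemma ivecBE (x y : ivec) i : (x - y) i 0 = x i 0 - y i 0.
Proof. by rewrite !mxE. Qed.

(** * The binary tree of unimodular pairs *)

Definition child (b : bool) (p : ivec * ivec) : ivec * ivec :=
  if b then (p.1, p.1 + p.2) else (p.1 + p.2, p.2).

Definition std_pair : ivec * ivec := (delta_mx 0 0, delta_mx 1 0).

Fixpoint node (w : seq bool) : ivec * ivec :=
  if w is b :: w' then child b (node w') else std_pair.

Lemma unimodular_child b p : unimodular_pairs p -> unimodular_pairs (child b p).
Proof.
move=> /unimodular_pairsE[a0 c0 b0 d0 det1]; apply/unimodular_pairsE.
by case: b; rewrite /= !mxE; split; rewrite ?addr_ge0 // -det1; ring.
Qed.

Lemma unimodular_std_pair : unimodular_pairs std_pair.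
Proof. by apply/unimodular_pairsE; rewrite /= !mxE. Qed.

Lemma unimodular_node w : unimodular_pairs (node w).
Proof.
elim: w => [|b w IHw] /=; first exact: unimodular_std_pair.
exact: unimodular_child.
Qed.

(** Equating children of different kinds makes a column of [p] plus a column of [p'] vanish; by
    nonnegativity both are zero, against determinant 1. *)
Lemma child_inj b b' p p' : unimodular_pairs p -> unimodular_pairs p' ->
  child b p = child b' p' -> b = b' /\ p = p'.
Proof.
move=> /unimodular_pairsE[a0 c0 b0 d0 det1] /unimodular_pairsE[a0' c0' b0' d0' det1'].
case: p p' a0 c0 b0 d0 det1 a0' c0' b0' d0' det1' => [x y] [x' y'] /=.
move=> a0 c0 b0 d0 det1 a0' c0' b0' d0' det1'.
case: b; case: b' => /=.
- by move=> [-> /addrI ->].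
- move=> [/matrixP e1 /matrixP e2].
  have := (e1 0 0, e1 1 0, e2 0 0, e2 1 0); rewrite !ivecDE => -[[[f0 f1] f2] f3].
  have [g0 g1] : y 0 0 = 0 /\ y 1 0 = 0 by lia.
  by move: det1; rewrite g0 g1 mulr0 mul0r.
- move=> [/matrixP e1 /matrixP e2].
  have := (e1 0 0, e1 1 0, e2 0 0, e2 1 0); rewrite !ivecDE => -[[[f0 f1] f2] f3].
  have [g0 g1] : x 0 0 = 0 /\ x 1 0 = 0 by lia.
  by move: det1; rewrite g0 g1 mulr0 mul0r.
- by move=> [xy yy]; move: xy; rewrite yy => /(@GRing.addIr _ _ _ _) ->.
Qed.

(** In a child one column dominates the other entrywise, which fails for the standard basis. *)
Lemma child_neq_std_pair b p : unimodular_pairs p -> child b p <> std_pair.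
Proof.
move=> /unimodular_pairsE[a0 c0 b0 d0 det1].
case: b => -[/matrixP e1 /matrixP e2];
  move: (e1 0 0) (e1 1 0) (e2 0 0) (e2 1 0);
  rewrite !ivecDE ![delta_mx _ _ _ _]mxE /= => f0 f1 f2 f3; nia.
Qed.

Lemma node_inj : injective node.
Proof.
elim=> [|b w IHw] [|b' w'] //=.
- by move/esym/child_neq_std_pair => /(_ (unimodular_node _)).
- by move/child_neq_std_pair => /(_ (unimodular_node _)).
by move=> /(child_inj (unimodular_node _) (unimodular_node _)) [-> /IHw ->].
Qed.

Definition weight (p : ivec * ivec) : int :=
  p.1 0 0 + p.1 1 0 + p.2 0 0 + p.2 1 0.

(** Euclidean descent: when one column dominates the other entrywise, subtracting the smaller one
    gives the parent, of smaller weight because columns are nonzero. *)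
Lemma node_surj p : unimodular_pairs p -> exists w, node w = p.
Proof.
have [n] := ubnP `|weight p|%N; elim: n p => // n IHn [x y].
rewrite /weight /= => ltn xyA.
have /unimodular_pairsE[/= a0 c0 b0 d0 det1] := xyA.
have [/andP[le0 le1]|] := boolP ((y 0 0 <= x 0 0) && (y 1 0 <= x 1 0)).
  case: (IHn (x - y, y)).
  - rewrite /weight /= !ivecBE; nia.
  - by apply/unimodular_pairsE; rewrite /= !ivecBE; split => //; nia.
  - by move=> w wE; exists (false :: w); rewrite /= wE /child /= subrK.
have [/andP[le0 le1] _|] := boolP ((x 0 0 <= y 0 0) && (x 1 0 <= y 1 0)).
  case: (IHn (x, y - x)).
  - rewrite /weight /= !ivecBE; nia.
  - by apply/unimodular_pairsE; rewrite /= !ivecBE; split => //; nia.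
  - by move=> w wE; exists (true :: w); rewrite /= wE /child /= addrC subrK.
move=> h1 h2; exists [::]; rewrite /= /std_pair.
(* As neither column dominates and the determinant is positive, [x 0 0 > y 0 0] and [y 1 0 > x 1 0].
   The determinant is then at least [1 + y 0 0 + x 1 0]. *)
have [e1 e2 e3 e4] : [/\ x 0 0 = 1, x 1 0 = 0, y 0 0 = 0 & y 1 0 = 1].
  by split; nia.
by congr pair; apply: cV2P; rewrite !mxE /= ?e1 ?e2 ?e3 ?e4.
Qed.

(** The root has weight 2, and each step adds the entries of a nonzero column. *)
Lemma weight_node w : (size w).+2%:Z <= weight (node w).
Proof.
elim: w => [|b w]; first by rewrite /weight /= !mxE.
have /unimodular_pairsE[] := unimodular_node w.
by case: b; rewrite /weight /= !ivecDE; nia.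
Qed.

(** * Sine estimates and polar angles *)

Lemma sin_bounds (R : realType) (t : R) :
  0 <= t <= pi -> t * cos t <= sin t <= t.
Proof.
move=> /andP[t0 tpi].
have [c] : exists2 c, c \in `[0, t] & sin t - sin 0 = cos c * (t - 0).
  apply: (@MVT_segment R sin cos) => //.
  by apply: continuous_subspaceT => x; exact: continuous_sin.
rewrite sin0 !subr0 in_itv /= => /andP[c0 ct] ->.
(* Cosine decreases on [0, pi], so [cos t <= cos c <= 1]. *)
rewrite mulrC ler_wpM2r //=; last first.
  have [->//|cltt] := eqVneq c t.
  apply: ltW; rewrite ltr_cos ?in_itv /= ?t0 ?c0 ?tpi ?(le_trans ct) //.
  by rewrite lt_neqAle cltt.
by rewrite ler_piMl // cos_le1.
Qed.

(** [acos] gives the argument in the upper half-plane only, which contains the closed first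
    quadrant. *)
Definition polar_angle (R : realType) (v : 'cV[R]_2) : R :=
  acos (v 0 0 / enorm v).

Lemma polar_angleP (R : realType) (v : 'cV[R]_2) :
  0 <= v 0 0 -> 0 <= v 1 0 -> 0 < enorm v ->
  [/\ cos (polar_angle v) = v 0 0 / enorm v,
      sin (polar_angle v) = v 1 0 / enorm v
    & 0 <= polar_angle v <= pi / 2].
Proof.
move=> v0 v1 vn.
have sqrE : enorm v ^+ 2 = v 0 0 ^+ 2 + v 1 0 ^+ 2.
  by rewrite enormE sqr_sqrtr // addr_ge0 // sqr_ge0.
have q0 : 0 <= v 0 0 / enorm v by rewrite divr_ge0 // ltW.
have q1 : v 0 0 / enorm v <= 1.
  rewrite ler_pdivrMr // mul1r -ler_sqr ?nnegrE ?(ltW vn) // sqrE.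
  by rewrite lerDl sqr_ge0.
have qB : -1 <= v 0 0 / enorm v <= 1 by rewrite q1 (le_trans _ q0) // lerN10.
have cosE : cos (polar_angle v) = v 0 0 / enorm v by rewrite acosK // in_itv.
split=> //.
  rewrite sin_acos //; have -> : 1 - (v 0 0 / enorm v) ^+ 2 = (v 1 0 / enorm v) ^+ 2.
    by rewrite !expr_div_n sqrE; field; rewrite -sqrE expf_neq0 ?gt_eqF.
  by rewrite sqrtr_sqr ger0_norm // divr_ge0 // ltW.
rewrite acos_ge0 //= leNgt; apply/negP => ltpi.
have := q0; rewrite -cosE leNgt => /negP; apply.
rewrite -(@cos_pihalf R) ltr_cos // in_itv /= ?acos_ge0 ?acos_lepi //.
by have := pi_ge0 R; lra.
Qed.

(** * Sines, angles and summands of unimodular pairs *)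

Definition sqnorm (v : ivec) : int := v 0 0 ^+ 2 + v 1 0 ^+ 2.

Lemma enorm_real_vec (R : realType) (v : ivec) :
  enorm (real_vec R v) = Num.sqrt (sqnorm v)%:~R.
Proof. by rewrite enormE !mxE /sqnorm intrD !rmorphXn. Qed.

Lemma sqnorm_gt0 p : unimodular_pairs p -> 0 < sqnorm p.1 /\ 0 < sqnorm p.2.
Proof. by move=> /unimodular_pairsE[]; rewrite /sqnorm; nia. Qed.

Lemma enorm_gt0 (R : realType) p : unimodular_pairs p ->
  0 < enorm (real_vec R p.1) /\ 0 < enorm (real_vec R p.2).
Proof. by move=> /sqnorm_gt0; rewrite !enorm_real_vec !sqrtr_gt0 !ltr0z. Qed.

(** A nonnegative integer is at most its square, so the two square norms add up to at least the
    weight; as both are at least 1, their product is at least their sum minus 1. *)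
Lemma sqnorm_node w :
  (size w).+1%:Z <= sqnorm (node w).1 * sqnorm (node w).2.
Proof.
have [a0 c0 b0 d0 det1] := (unimodular_pairsE (node w)).1 (unimodular_node w).
have := weight_node w; rewrite /weight.
have normge (v : ivec) : 0 <= v 0 0 -> 0 <= v 1 0 -> v 0 0 + v 1 0 <= sqnorm v.
  have le_sqr (a : int) : 0 <= a -> a <= a ^+ 2 by nia.
  by move=> /le_sqr ? /le_sqr ?; exact: lerD.
have [s1 s2] := sqnorm_gt0 (unimodular_node w).
have := (normge _ a0 c0, normge _ b0 d0) => -[]; nia.
Qed.

(* By [angleP], the sine of the angle from [p.1] to [p.2] when [p] is unimodular. *)
Definition sine (R : realType) (p : ivec * ivec) : R :=
  (enorm (real_vec R p.1) * enorm (real_vec R p.2))^-1.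

Definition angle (R : realType) (p : ivec * ivec) : R :=
  polar_angle (real_vec R p.2) - polar_angle (real_vec R p.1).

Lemma sine_gt0 (R : realType) p : unimodular_pairs p -> 0 < sine R p.
Proof. by move=> /(enorm_gt0 R)[? ?]; rewrite invr_gt0 mulr_gt0. Qed.

Lemma sine_node_sqr (R : realType) w : sine R (node w) ^+ 2 <= (size w).+1%:R^-1.
Proof.
have [s1 s2] := sqnorm_gt0 (unimodular_node w).
rewrite /sine !enorm_real_vec exprVn exprMn !sqr_sqrtr ?ler0z ?(ltW s1) ?(ltW s2) // -intrM.
rewrite lef_pV2 ?posrE ?ltr0z ?mulr_gt0 ?ltr0n //.
by rewrite -[_%:R]/(_%:Z%:~R) ler_int sqnorm_node.
Qed.

(** The subtraction formula gives the determinant, 1, over the product of the norms. A negative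
    angle would have a nonpositive sine. *)
Lemma angleP (R : realType) p : unimodular_pairs p ->
  [/\ 0 <= angle R p, angle R p <= pi / 2 & sin (angle R p) = sine R p].
Proof.
move=> pA; have /unimodular_pairsE[a0 c0 b0 d0 det1] := pA.
have [x0 y0] := enorm_gt0 R pA.
have [|||cx sx /andP[bx1 bx2]] := @polar_angleP R (real_vec R p.1); rewrite ?mxE ?ler0z //.
have [|||cy sy /andP[by1 by2]] := @polar_angleP R (real_vec R p.2); rewrite ?mxE ?ler0z //.
have sinE : sin (angle R p) = sine R p.
  rewrite sinB cx cy sx sy !mxE.
  have -> : sine R p = (p.1 0 0 * p.2 1 0 - p.2 0 0 * p.1 1 0)%:~R * sine R p.
    by rewrite det1 mul1r.
  by rewrite /sine rmorphB !rmorphM /=; field; rewrite !gt_eqF.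
split=> //; last by rewrite /angle; lra.
rewrite leNgt; apply/negP => neg.
have : 0 <= sin (- angle R p).
  by apply: sin_ge0_pi; have := pi_ge0 R; move: neg; rewrite /angle; lra.
by rewrite sinN sinE oppr_ge0 leNgt sine_gt0.
Qed.

Lemma sine_le_angle (R : realType) p : unimodular_pairs p ->
  sine R p <= angle R p.
Proof.
move=> /(angleP R)[t0 t1 <-].
have tpi : 0 <= angle R p <= pi by have := pi_ge0 R; lra.
by have /andP[] := sin_bounds tpi.
Qed.

(* The bound (1 - 1 / (n + 1)) angle <= sine with n the depth of the node,
   cleared of denominators so that it can be summed over a level using only
   additivity. *)
Lemma angle_le_sine (R : realType) w :
  angle R (node w) *+ (size w).+1 <=
  sine R (node w) *+ (size w).+1 + angle R (node w).
Proof.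
have [t0 t1 sinE] := angleP R (unimodular_node w).
move: (sine_node_sqr R w); rewrite -sinE.
set t := angle R (node w) in t0 t1 *; set n := (size w).+1 => sin_le.
have /andP[tcos _] : t * cos t <= sin t <= t.
  by apply: sin_bounds; have := pi_ge0 R; lra.
have cos0 : 0 <= cos t by apply: cos_ge0_pihalf; have := pi_ge0 R; lra.
(* As [0 <= cos t <= 1], [cos t] is at least its square, which is [1 - sin t ^+ 2]. *)
have cos_ge : 1 - n%:R^-1 <= cos t.
  apply: (@le_trans _ _ (cos t ^+ 2)); first by rewrite cos2sin2 lerB.
  by rewrite expr2 ler_piMl // cos_le1.
have le_s : t * (1 - n%:R^-1) <= sin t.
  by apply: le_trans tcos; rewrite ler_wpM2l.
have n0 : 0 < n%:R :> R by rewrite ltr0n.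
rewrite -lerBlDr -(mulr_natr t) -(mulr_natr (sin t)) -ler_pdivrMr //.
by rewrite mulrBl mulfK ?gt_eqF // -[X in X - _]mulr1 -mulrBr.
Qed.

(** Partial fractions. The sine of [p] is added on the left so that all terms are nonnegative when
    summed in the extended reals. *)
Lemma summand_sine (R : realType) p : unimodular_pairs p ->
  summand (real_vec R p.1) (real_vec R p.2) + sine R p =
  sine R (child true p) + sine R (child false p).
Proof.
move=> pA; have [x0 y0] := enorm_gt0 R pA.
have [_ /= z0] := enorm_gt0 R (unimodular_child true pA).
rewrite /summand /sine /= -[real_vec R p.1 + _]map_mxD -/(real_vec R (p.1 + p.2)).
by field; rewrite !gt_eqF.
Qed.

(** The children share the vector [p.1 + p.2], whose polar angle cancels. *)
Lemma angle_child (R : realType) p :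
  angle R p = angle R (child true p) + angle R (child false p).
Proof. by rewrite /angle /=; ring. Qed.

Lemma enormD (R : realType) (x y : 'cV[R]_2) : enorm (x + y) <= enorm x + enorm y.
Proof.
have sq0 (v : 'cV[R]_2) : 0 <= v 0 0 ^+ 2 + v 1 0 ^+ 2 by rewrite addr_ge0 // sqr_ge0.
rewrite -ler_sqr ?nnegrE ?addr_ge0 ?sqrtr_ge0 //.
rewrite sqrrD !enormE !sqr_sqrtr // -sqrtrM // !mxE.
have : x 0 0 * y 0 0 + x 1 0 * y 1 0 <=
    Num.sqrt ((x 0 0 ^+ 2 + x 1 0 ^+ 2) * (y 0 0 ^+ 2 + y 1 0 ^+ 2)).
  apply: le_trans (ler_norm _) _; rewrite -sqrtr_sqr ler_wsqrtr //.
  (* Cauchy-Schwarz from Lagrange's identity: this square is the defect. *)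
  by have := sqr_ge0 (x 0 0 * y 1 0 - x 1 0 * y 0 0); nra.
by set s := Num.sqrt _; rewrite mulr2n; nra.
Qed.

Lemma summand_ge0 (R : realType) (x y : 'cV[R]_2) : 0 <= summand x y.
Proof. by rewrite divr_ge0 ?mulr_ge0 ?sqrtr_ge0 // subr_ge0 enormD. Qed.

(** * Sums over the levels of the tree *)

Local Open Scope ereal_scope.

Definition level_sum (R : realType) (h : ivec * ivec -> R) (n : nat) : \bar R :=
  \esum_(w in [set w : seq bool | size w = n]) (h (node w))%:E.

Lemma level_sum0 (R : realType) (h : ivec * ivec -> R) :
  (0 <= h std_pair)%R -> level_sum h 0 = (h std_pair)%:E.
Proof.
move=> h0; rewrite /level_sum.
have -> : [set w : seq bool | size w = 0%N] = [set [::]].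
  by apply/seteqP; split=> [w /size0nil ->//|w ->].
by rewrite esum_set1 // lee_fin.
Qed.

Lemma level_sumD (R : realType) (h k : ivec * ivec -> R) n :
  (forall p, unimodular_pairs p -> 0 <= h p)%R ->
  (forall p, unimodular_pairs p -> 0 <= k p)%R ->
  level_sum (fun p => h p + k p)%R n = level_sum h n + level_sum k n.
Proof.
move=> h0 k0; rewrite /level_sum -esumD => [|w _|w _].
- by apply: eq_esum => w _; rewrite EFinD.
- by rewrite lee_fin h0 //; exact: unimodular_node.
- by rewrite lee_fin k0 //; exact: unimodular_node.
Qed.

Lemma eq_level_sum (R : realType) (h k : ivec * ivec -> R) n :
  (forall p, unimodular_pairs p -> h p = k p) -> level_sum h n = level_sum k n.
Proof. by move=> hk; apply: eq_esum => w _; rewrite hk //; exact: unimodular_node. Qed.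

(** The head of a word is the last step down the tree, so splitting level [n.+1] by heads pairs the
    two children of each node of level [n]. *)
Lemma level_sumS (R : realType) (h : ivec * ivec -> R) n :
  (forall p, unimodular_pairs p -> 0 <= h p)%R ->
  level_sum h n.+1 = level_sum (fun p => h (child true p) + h (child false p))%R n.
Proof.
move=> h0.
rewrite level_sumD => [|p pA|p pA]; do ?by apply: h0; exact: unimodular_child.
(* The default of [head] is never reached: words of length [n.+1] are nonempty. *)
rewrite /level_sum (esumID [set w | head false w]); last first.
  by move=> w _; rewrite lee_fin h0 //; exact: unimodular_node.
have imE b : cons b @` [set w | size w = n] =
    [set w | size w = n.+1] `&` [set w | head false w = b].
  apply/seteqP; split=> [_ [w /= <- <-]//|[|b' w] [] //= [wn] b'E].
  by exists w; rewrite ?b'E.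
congr (_ + _).
  rewrite -[X in \esum_(_ in X) _](imE true) esum_image //.
  by move=> w w' _ _ [].
have -> : ~` [set w | head false w] = [set w : seq bool | head false w = false].
  by apply/seteqP; split=> w /= /negP; [move/negbTE | case: head].
rewrite -imE esum_image //.
by move=> w w' _ _ [].
Qed.

Lemma level_sum_angle (R : realType) n : level_sum (@angle R) n = (pi / 2)%:E.
Proof.
elim: n => [|n IHn].
  have rootE : angle R std_pair = (pi / 2)%R.
    rewrite /angle /polar_angle !enormE !mxE /= !(expr0n, expr1n) /=.
    by rewrite addr0 add0r sqrtr1 !divr1 acos0 acos1 subr0.
  by rewrite level_sum0 rootE // divr_ge0 ?pi_ge0.
rewrite level_sumS => [|p /(angleP R)[]//]; rewrite -IHn.
by apply: eq_level_sum => p _; rewrite -angle_child.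
Qed.

Lemma level_sum_sine_le (R : realType) n : level_sum (@sine R) n <= (pi / 2)%:E.
Proof.
rewrite -(level_sum_angle R n); apply: le_esum => w _.
by rewrite lee_fin sine_le_angle //; exact: unimodular_node.
Qed.

Lemma level_sumMn (R : realType) (h : ivec * ivec -> R) n m :
  (forall p, unimodular_pairs p -> 0 <= h p)%R ->
  level_sum (fun p => h p *+ m)%R n = level_sum h n *+ m.
Proof.
move=> h0; elim: m => [|m IHm]; first by rewrite mule0n; exact: esum1.
rewrite muleS -IHm -level_sumD // => [|p pA]; last by rewrite mulrn_wge0 // h0.
by apply: eq_level_sum => p _; rewrite mulrS.
Qed.

Lemma level_sum_sine_ge (R : realType) n :
  (pi / 2)%:E *+ n <= level_sum (@sine R) n *+ n.+1.
Proof.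
have s0 p : unimodular_pairs p -> (0 <= sine R p)%R.
  by move=> pA; exact/ltW/sine_gt0.
have t0 p : unimodular_pairs p -> (0 <= angle R p)%R by case/(angleP R).
(* Adding [pi / 2], the total angle of the level, to both sides leaves the sum of [angle_le_sine]
   over the level. *)
rewrite -(@leeD2rE _ (pi / 2)%:E) // addeC -muleS -(level_sum_angle R n).
rewrite -!level_sumMn // -level_sumD // => [|p pA]; last by rewrite mulrn_wge0 // s0.
by apply: le_esum => w /= wn; rewrite lee_fin -wn angle_le_sine.
Qed.

(** Telescoping by [summand_sine]; the 1 is the sine at the root. *)
Lemma series_level_sum (R : realType) n :
  \sum_(0 <= k < n) level_sum (fun p => summand (real_vec R p.1) (real_vec R p.2)) k + 1
  = level_sum (@sine R) n.
Proof.
elim: n => [|n IHn].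
  rewrite big_geq // add0e level_sum0 ?sine_gt0 ?ltW //; last first.
    by apply: sine_gt0; exact: unimodular_std_pair.
  congr _%:E; rewrite /sine !enormE !mxE /= !(expr0n, expr1n) /=.
  by rewrite addr0 add0r sqrtr1 mulr1 invr1.
rewrite big_nat_recr //= addeAC IHn addeC -level_sumD; last 2 first.
- by move=> p _; exact: summand_ge0.
- by move=> p pA; apply/ltW/sine_gt0.
rewrite level_sumS => [|p pA]; last exact/ltW/sine_gt0.
by apply: eq_level_sum => p; exact: summand_sine.
Qed.

Lemma level_sum_sine_fine (R : realType) n :
  (fine (level_sum (@sine R) n))%:E = level_sum (@sine R) n.
Proof.
rewrite fineK // ge0_fin_numE; first exact: le_lt_trans (level_sum_sine_le R n) (ltry _).
by apply: esum_ge0 => w _; rewrite lee_fin ltW // sine_gt0 //; exact: unimodular_node.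
Qed.

Lemma cvg_level_sum_sine (R : realType) :
  (fun n => fine (level_sum (@sine R) n)) @ \oo --> (pi / 2 : R)%R.
Proof.
apply: (@squeeze_cvgr _ _ _ _ (fun n => (1 - harmonic n) * (pi / 2))%R (fun=> pi / 2)%R).
- apply: nearW => n; apply/andP; split.
    have := level_sum_sine_ge R n.
    rewrite -(level_sum_sine_fine R n) -!EFin_natmul lee_fin.
    set r := fine _; rewrite -(mulr_natr r) -(mulr_natr (pi / 2)) -ler_pdivrMr ?ltr0n // => le_r.
    (* [harmonic n] is 1 / (n + 1), so the two lower bounds agree. *)
    apply: le_trans le_r; rewrite /harmonic le_eqVlt; apply/orP; left; apply/eqP.
    by rewrite -(natr1 n) /=; field; rewrite natr1 pnatr_eq0.
  by rewrite -lee_fin level_sum_sine_fine level_sum_sine_le.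
- rewrite [X in _ --> X](_ : _ = (1 - 0) * (pi / 2))%R; last by rewrite subr0 mul1r.
  by apply: cvgM; [|exact: cvg_cst]; apply: cvgB; [exact: cvg_cst | exact: cvg_harmonic].
- exact: cvg_cst.
Qed.

(** * Summation over all unimodular pairs *)

Lemma node_bij : set_bij [set: seq bool] unimodular_pairs node.
Proof.
split=> [w _|w w' _ _|p /node_surj[w <-]]; first exact: unimodular_node.
- exact: node_inj.
- by exists w.
Qed.

Local Close Scope ereal_scope.

Theorem theorem2 (R : realType) :
  (\esum_(p in unimodular_pairs)
     (summand (real_vec R p.1) (real_vec R p.2))%:E)%E =
  (pi / 2 - 1)%:E.
Proof.
rewrite (reindex_esum _ _ _ _ node_bij).
(* Grouping words by length turns the sum into the series of level sums. *)
have -> : [set: seq bool] = \bigcup_(n in setT) [set w | size w = n].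
  by apply/seteqP; split=> // w _; exists (size w).
rewrite esum_bigcupT => [|n m _ _ [w [/= <- <-]]//|w]; last first.
  by rewrite lee_fin summand_ge0.
rewrite -nneseries_esumT => [|n]; last first.
  by apply: esum_ge0 => w _; rewrite lee_fin summand_ge0.
apply: cvg_lim => //.
(* The partial sums telescope to finite values, so the limit can be taken in the reals. *)
rewrite (_ : (fun n => _) = (fun n => (fine (level_sum (@sine R) n) - 1)%:E)).
  apply: cvg_EFin; first by apply: nearW.
  by apply: cvgB; [exact: cvg_level_sum_sine | exact: cvg_cst].
apply/funext => n; rewrite EFinB level_sum_sine_fine -series_level_sum.
by rewrite addeK.
Qed.
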